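(* Let $n\ge1$, $0\le N_b<n$, $p\in[0,1]$, and $N_l=n-N_b$. In the $p$-parking process on $\mathbb{Z}/n\mathbb{Z}$ with $N_b$ cars, let $H^1$ be the set of free parking spots after all cars have parked. For every $X\subseteq\mathbb{Z}/n\mathbb{Z}$ with $|X|=N_l$, writing $\ell_i=\Delta_iX$ for $i\in\mathbb{Z}/N_l\mathbb{Z}$, $$\mathbb{P}(H^1=X)=\frac{1}{n^{N_b}}\binom{N_b}{\ell_1,\dots,\ell_{N_l}}\prod_{i\in\mathbb{Z}/N_l\mathbb{Z}}(\ell_i+1)^{\ell_i-1}.$$ In particular it does not depend on $p$.
   Context: $p$-parking process: initially every vertex of $\mathbb{Z}/n\mathbb{Z}$ is a free parking spot. $N_b$ cars arrive successively; the $i$-th car chooses a vertex $v_i$ uniformly at random, independently of everything else, and from $v_i$ performs a random walk (from $k$ to $k+1\bmod n$ w.p. $p$, to $k-1\bmod n$ w.p. $1-p$) until it is at a free spot (possibly $v_i$ itself), where it parks; that spot is then occupied forever. Block notation: with $\pi:\mathbb{Z}/n\mathbb{Z}\to\{1,\dots,n\}$ the canonical bijection, a set $X$ of size $k$ is listed as $(x_i)_{i\in\mathbb{Z}/k\mathbb{Z}}$ with $\pi(x_1)<\dots<\pi(x_k)=\pi(x_0)$, and $\Delta_iX=\pi(x_{i+1})-\pi(x_i)-1\bmod n$. *)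

(* Defs.v *)
From HB Require Import structures.
From mathcomp Require Import all_boot all_order all_algebra.
From mathcomp Require Import all_classical all_reals all_analysis.
Set Implicit Arguments. Unset Strict Implicit. Unset Printing Implicit Defensive.
Import Order.TTheory GRing.Theory Num.Theory numFieldNormedType.Exports.
Local Open Scope ring_scope.

(* Vertices of Z/nZ are represented by 'I_n; the canonical bijection
   pi : Z/nZ -> {1..n} is pi(k) = val k + 1, so it preserves the order of val.
   Successor k -> k+1 mod n is [ordS], predecessor is [ord_pred]. *)

(* hit p t O v f : probability that a walker started at v, moving to k+1 w.p. p
   and to k-1 w.p. 1-p, is at a free spot (not in the occupied set O) within
   t steps and the first free spot it reaches is f. *)
Fixpoint hit (R : realType) (n : nat) (p : R) (t : nat) (O : {set 'I_n})
    (v f : 'I_n) {struct t} : R :=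
  if v \notin O then (v == f)%:R else
  match t with
  | 0 => 0
  | t'.+1 => p * hit p t' O (ordS v) f + (1 - p) * hit p t' O (ord_pred v) f
  end.

Definition absorb (R : realType) (n : nat) (p : R) (O : {set 'I_n}) (v f : 'I_n) : R :=
  limn ((fun t => hit p t O v f) : R^nat).

Fixpoint park_dist (R : realType) (n : nat) (p : R) (k : nat) : {set 'I_n} -> R :=
  match k with
  | 0 => fun O => (O == finset.set0)%:R
  | k'.+1 => fun O' =>
      \sum_(O : {set 'I_n}) park_dist p k' O *
        \sum_(v : 'I_n) (n%:R)^-1 *
          \sum_(f : 'I_n | (f \notin O) && (O' == f |: O)) absorb p O v f
  end.

Definition prob_free_set (R : realType) (n : nat) (p : R) (Nb : nat) (X : {set 'I_n}) : R :=
  park_dist p Nb (~: X).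

Definition sorted_elems (n : nat) (X : {set 'I_n}) : seq nat :=
  sort leq [seq val x | x <- enum X].

(* Delta_i X for i in Z/|X|Z (0-indexed here: x_0 < ... < x_{k-1}, the
   successor index of i is (i+1) mod k):
   Delta_i X = pi(x_{i+1}) - pi(x_i) - 1 mod n. *)
Definition Delta (n : nat) (X : {set 'I_n}) (i : nat) : nat :=
  let s := sorted_elems X in
  let k := #|X| in
  ((nth 0%N s ((i.+1) %% k) + n - nth 0%N s i - 1) %% n)%N.

(* Main.v *)
Require Import Defs.
From HB Require Import structures.
From mathcomp Require Import all_boot all_order all_algebra.
From mathcomp Require Import all_classical all_reals all_analysis.
From mathcomp Require Import zify ring lra.
Set Implicit Arguments. Unset Strict Implicit. Unset Printing Implicit Defensive.
Import Order.TTheory GRing.Theory Num.Theory numFieldNormedType.Exports.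
Local Open Scope ring_scope.

(** Induct on the number of cars. The weight of a configuration is the product,
    over its blocks of length l, of w(l) = (l+1)^(l-1) / l!. If the last car
    fills the spot f, turning blocks of lengths a and b into one of length
    a+b+1, its choice of starting point contributes
    1 + (expected number of exits to the right from the a-block)
      + (expected number of exits to the left from the b-block).
    Each of the two terms depends on p, but after exchanging the roles of a and b
    in the sum over a+b they are complementary and add up to b, which leaves
    sum_(a+b=m) w(a) w(b) (b+1) = (m+1) w(m+1): Abel's identity. *)

(** * Arcs of the circle *)

Definition cshift n (x : 'I_n) (j : nat) : 'I_n := iter j (@ordS n) x.

(** For [x] in [X], the length of the block of sites outside [X] after [x]; [n] offsets suffice
    because [cshift x n = x]. Blocks are thus indexed by the free site before them, without sorting
    [X]. *)
Definition gap n (X : {set 'I_n}) (x : 'I_n) : nat :=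
  find (fun j => cshift x j.+1 \in X) (iota 0 n).

Lemma val_cshift n (x : 'I_n) j : val (cshift x j) = ((x + j) %% n)%N.
Proof.
elim: j => [|j IH] /=; first by rewrite addn0 modn_small.
by rewrite /= in IH; rewrite IH -addn1 modnDml addn1 addnS.
Qed.

Lemma cshiftD n (x : 'I_n) i j : cshift (cshift x i) j = cshift x (i + j).
Proof. by rewrite /cshift -iterD addnC. Qed.

Lemma cshift_inj n j : injective (fun x : 'I_n => cshift x j).
Proof.
elim: j => [|j IH] x y //= /(can_inj (@ordSK n)); exact: IH.
Qed.

Lemma cshift_n n (x : 'I_n) : cshift x n = x.
Proof. by apply: val_inj; rewrite val_cshift modnDr modn_small. Qed.

Lemma gapP n (X : {set 'I_n}) (x : 'I_n) : x \in X ->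
  cshift x (gap X x).+1 \in X /\
  forall j, (j < gap X x)%N -> cshift x j.+1 \notin X.
Proof.
case: n X x => [|m] X x xX; first by case: x xX.
have hasX : has (fun j => cshift x j.+1 \in X) (iota 0 m.+1).
  apply/hasP; exists m; first by rewrite mem_iota /=.
  by rewrite cshift_n.
have ltg : (gap X x < m.+1)%N by move: hasX; rewrite has_find size_iota.
split.
  by have := nth_find 0%N hasX; rewrite nth_iota // add0n.
move=> j ltj; have /negbT := before_find 0%N ltj.
by rewrite nth_iota ?add0n // (ltn_trans ltj).
Qed.

Lemma gap_eq n (X : {set 'I_n}) (x : 'I_n) g : x \in X ->
  cshift x g.+1 \in X -> (forall j, (j < g)%N -> cshift x j.+1 \notin X) ->
  gap X x = g.
Proof.
move=> /gapP[Xg notX] Xg' notX'.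
case: (ltngtP (gap X x) g) => // [/notX'|/notX]; first by rewrite Xg.
by rewrite Xg'.
Qed.

Lemma gap_cshift_notin {n} {X : {set 'I_n}} {x : 'I_n} {j} : x \in X ->
  (0 < j <= gap X x)%N -> cshift x j \notin X.
Proof.
by move=> /gapP[_ notX]; case: j => // j /= /notX.
Qed.

(** Cancelling the common shift leaves [x] at distance [j - i] after [y]; were this positive, [x]
    would lie inside the block of [y]. *)
Lemma cshift_gap_inj n (X : {set 'I_n}) (x y : 'I_n) i j :
  x \in X -> y \in X -> (i <= gap X x)%N -> (j <= gap X y)%N ->
  cshift x i = cshift y j -> x = y /\ i = j.
Proof.
wlog le_ij : x y i j / (i <= j)%N => [hw|] xX yX lei lej eq_s.
  case/orP: (leq_total i j) => le; first exact: hw.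
  by case: (hw y x j i le yX xX lej lei (esym eq_s)) => -> ->.
have eqx : x = cshift y (j - i).
  apply: (@cshift_inj n i); rewrite cshiftD subnK //.
case: (posnP (j - i)) => [ji0|ji_gt0].
  by rewrite ji0 in eqx; split=> //; lia.
have /(gap_cshift_notin yX) : (0 < j - i <= gap X y)%N by lia.
by rewrite -eqx xX.
Qed.

Lemma cshift_gap_surj n (X : {set 'I_n}) (v : 'I_n) : X != finset.set0 ->
  exists x j, [/\ x \in X, (j <= gap X x)%N & v = cshift x j].
Proof.
case/set0Pn => y yX.
have exj : exists j, [exists x, (x \in X) && (cshift x j == v)].
  exists (v + (n - y))%N; apply/existsP; exists y; rewrite yX /=.
  apply/eqP/val_inj; rewrite val_cshift /=.
  have -> : (y + (v + (n - y)) = v + n)%N by have := ltn_ord y; lia.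
  by rewrite modnDr modn_small.
case: (ex_minnP exj) => j /existsP[x /andP[xX /eqP eqv]] minj.
(* Beyond the gap, the next element of [X] would be closer to [v], against minimality. *)
exists x, j; split=> //; rewrite leqNgt; apply/negP => ltj.
have : (j <= j - (gap X x).+1)%N; last by lia.
apply: minj; apply/existsP; exists (cshift x (gap X x).+1).
by rewrite (gapP xX).1 cshiftD subnKC //= eqv eqxx.
Qed.

Lemma ltn_gap n (X : {set 'I_n}) (x : 'I_n) : x \in X -> (gap X x < n)%N.
Proof.
move=> xX; rewrite ltnNge; apply/negP => le.
have n0 : (0 < n)%N := leq_ltn_trans (leq0n x) (ltn_ord x).
have /(gap_cshift_notin xX) : (0 < n <= gap X x)%N by rewrite n0.
by rewrite cshift_n xX.
Qed.

(** The arcs, each a site of [X] with the block after it, partition the circle. *)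
Lemma sum_arcs (V : nmodType) n (X : {set 'I_n}) (F : 'I_n -> V) :
  X != finset.set0 ->
  \sum_v F v = \sum_(x in X) \sum_(j < (gap X x).+1) F (cshift x j).
Proof.
move=> X0.
pose A := [set u : 'I_n * 'I_n | (u.1 \in X) && (u.2 <= gap X u.1)%N].
pose h (u : 'I_n * 'I_n) := cshift u.1 u.2.
have hA : h @: A = [set: 'I_n].
  apply/setP => v; rewrite inE; apply/imsetP.
  have [x [j [xX lej ->]]] := cshift_gap_surj v X0.
  exists (x, Ordinal (leq_ltn_trans lej (ltn_gap xX))) => //.
  by rewrite inE xX.
have injh : {in A &, injective h}.
  move=> [x i] [y j]; rewrite !inE /h /= => /andP[xX lei] /andP[yX lej].
  by move=> /(cshift_gap_inj xX yX lei lej)[-> /val_inj ->].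
transitivity (\sum_(v in h @: A) F v).
  by rewrite hA; apply: eq_bigl => v; rewrite inE.
rewrite big_imset //=.
transitivity (\sum_(x in X) \sum_(j < n | (j <= gap X x)%N) F (cshift x j)).
  rewrite pair_big_dep /=; apply: eq_bigl => u; by rewrite inE.
apply: eq_bigr => x xX.
by rewrite [RHS](big_ord_widen n (fun j => F (cshift x j))) ?ltn_gap.
Qed.

Lemma sum_arcsC (V : nmodType) n (X : {set 'I_n}) (F : 'I_n -> V) :
  X != finset.set0 ->
  \sum_(v in ~: X) F v =
  \sum_(x in X) \sum_(j < gap X x) F (cshift x j.+1).
Proof.
move=> X0; rewrite big_mkcond (sum_arcs _ X0) /=; apply: eq_bigr => x xX.
rewrite big_ord_recl inE xX add0r; apply: eq_bigr => j _.
by rewrite inE lift0 (gap_cshift_notin xX) ?ltn_ord.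
Qed.

Lemma sum_gap n (X : {set 'I_n}) : X != finset.set0 ->
  (\sum_(x in X) gap X x = #|~: X|)%N.
Proof.
move=> X0; rewrite -sum1_card (sum_arcsC (fun=> 1%N) X0).
apply: eq_bigr => x _.
by rewrite -[RHS]/(\sum_(j < gap X x) 1)%N sum1_card card_ord.
Qed.

(** * Splitting a block by freeing one of its sites *)

Section AddSite.
Variables (n : nat) (X : {set 'I_n}) (x : 'I_n) (i : nat).
Hypotheses (xX : x \in X) (lti : (i < gap X x)%N).
Let f := cshift x i.+1.

Lemma gap_setU1_left : gap (f |: X) x = i.
Proof.
apply: gap_eq => [||j ltj]; rewrite ?inE ?xX ?eqxx ?orbT //.
rewrite negb_or (gapP xX).2 ?(ltn_trans ltj) // andbT.
apply/eqP => /(cshift_gap_inj xX xX); case=> //; lia.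
Qed.

Lemma gap_setU1_right : gap (f |: X) f = (gap X x - i.+1)%N.
Proof.
have [Xg notX] := gapP xX.
apply: gap_eq => [||j ltj]; rewrite ?inE ?eqxx //.
  by rewrite cshiftD addnS subnKC // Xg orbT.
rewrite negb_or cshiftD addnS notX ?andbT; last by lia.
by apply/eqP => /(cshift_gap_inj xX xX); case=> //; lia.
Qed.

Lemma gap_setU1_other y : y \in X -> y != x -> gap (f |: X) y = gap X y.
Proof.
move=> yX /eqP yx; have [Xg notX] := gapP yX.
apply: gap_eq => [||j ltj]; rewrite ?inE ?yX ?Xg ?orbT //.
rewrite negb_or notX // andbT.
by apply/eqP => /(cshift_gap_inj yX xX); case=> //; lia.
Qed.

(** Two arcs with the same end have the same last site, hence the same start. *)
Lemma next_setU1 y : y \in f |: X ->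
  (cshift y (gap (f |: X) y).+1 == f) = (y == x).
Proof.
move=> yX; have xX' : x \in f |: X by rewrite !inE xX orbT.
apply/eqP/eqP => [|->]; last by rewrite gap_setU1_left.
move=> e.
have : cshift y (gap (f |: X) y).+1 = cshift x (gap (f |: X) x).+1.
  by rewrite e gap_setU1_left.
move=> /(can_inj (@ordSK n)) eqs.
by have [] := cshift_gap_inj yX xX' (leqnn _) (leqnn _) eqs.
Qed.

End AddSite.

(** Compares the configurations before and after the last car: only the block of [x] differs, so a
    single factor is replaced by two. *)
Lemma prod_gap_setU1 (R : comNzRingType) (w : nat -> R) n (X : {set 'I_n})
    (x : 'I_n) i (f := cshift x i.+1) : x \in X -> (i < gap X x)%N ->
  \prod_(y in f |: X) w (gap (f |: X) y) =
  w i * w (gap X x - i.+1)%N * \prod_(y in X | y != x) w (gap X y).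
Proof.
move=> xX lti; rewrite big_setU1 /=; last exact: (gapP xX).2.
rewrite (bigD1 x) //= gap_setU1_left // gap_setU1_right // mulrCA mulrA.
by congr (_ * _); apply: eq_bigr => y /andP[yX yx]; rewrite gap_setU1_other.
Qed.

(** * Exit of a walk from a block *)

Section Walk.
Variables (R : realType) (p : R).
Hypotheses (p_ge0 : 0 <= p) (p_le1 : p <= 1).

(* Expected payoff [phi] at the exit point of the walk on the line started at
   [j] and killed at time [t]; the exit points are [0] and [g.+1]. *)
Fixpoint walk (phi : nat -> R) (g t j : nat) : R :=
  if (j == 0%N) || (g < j)%N then phi j else
  match t with
  | 0 => 0
  | t'.+1 => p * walk phi g t' j.+1 + (1 - p) * walk phi g t' j.-1
  end.

Lemma walk_bdry phi g t j : (j == 0%N) || (g < j)%N -> walk phi g t j = phi j.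
Proof. by case: t => [|t] /= ->. Qed.

Lemma walkS phi g t j : (0 < j <= g)%N ->
  walk phi g t.+1 j = p * walk phi g t j.+1 + (1 - p) * walk phi g t j.-1.
Proof. by move=> bj /=; have -> : (j == 0%N) || (g < j)%N = false by lia. Qed.

Lemma walk_linear a b phi psi g t j :
  walk (fun i => a * phi i + b * psi i) g t j =
  a * walk phi g t j + b * walk psi g t j.
Proof.
elim: t j => [|t IH] j /=; case: ifP => // _; first by ring.
by rewrite !IH; ring.
Qed.

(** A walk started in [[0, g.+1]] can stop only at one of the two ends, so no other value of the
    payoff counts. *)
Lemma eq_walk phi psi g t j : phi 0%N = psi 0%N -> phi g.+1 = psi g.+1 ->
  (j <= g.+1)%N -> walk phi g t j = walk psi g t j.
Proof.
move=> e0 eg; elim: t j => [|t IH] j lej.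
  rewrite /=; case: ifP => // /orP[/eqP -> //|ltgj].
  by have -> : j = g.+1 by apply/eqP; rewrite eqn_leq lej.
case: (boolP ((j == 0%N) || (g < j)%N)) => [bj|].
  rewrite !walk_bdry //; case/orP: bj => [/eqP -> //|ltgj].
  by have -> : j = g.+1 by apply/eqP; rewrite eqn_leq lej.
move=> nbj; have bj : (0 < j <= g)%N by lia.
by rewrite (walkS phi t bj) (walkS psi t bj) !IH //; lia.
Qed.

Lemma walk_ge0 phi g t j : (forall i, 0 <= phi i) -> 0 <= walk phi g t j.
Proof.
move=> phi0; elim: t j => [|t IH] j /=; case: ifP => // _.
by rewrite addr_ge0 // mulr_ge0 // subr_ge0.
Qed.

Lemma walk_le1 phi g t j : (forall i, phi i <= 1) -> walk phi g t j <= 1.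
Proof.
move=> phi1; elim: t j => [|t IH] j /=; case: ifP => // _.
have q_ge0 : 0 <= 1 - p by rewrite subr_ge0.
have := ler_wpM2l p_ge0 (IH j.+1); have := ler_wpM2l q_ge0 (IH j.-1); lra.
Qed.

(** A killed walk pays 0, so with a nonnegative payoff extra time can only add. *)
Lemma walk_nondecreasing phi g j : (forall i, 0 <= phi i) ->
  nondecreasing_seq (fun t => walk phi g t j).
Proof.
move=> phi0; apply/nondecreasing_seqP => t; elim: t j => [|t IH] j.
  rewrite [X in X <= _]/=; case: ifP => [bj|_]; last exact: walk_ge0.
  by rewrite walk_bdry.
case: (boolP ((j == 0%N) || (g < j)%N)) => [bj|nbj]; first by rewrite !walk_bdry.
have bj : (0 < j <= g)%N by lia.
by rewrite (walkS phi t.+1 bj) (walkS phi t bj) lerD // ler_wpM2l // subr_ge0.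
Qed.

Lemma is_cvg_walk phi g j : (forall i, 0 <= phi i <= 1) ->
  cvgn (fun t => walk phi g t j).
Proof.
move=> phi01; apply: nondecreasing_is_cvgn.
  by apply: walk_nondecreasing => i; case/andP: (phi01 i).
exists 1 => _ [t _ <-]; apply: walk_le1 => i; by case/andP: (phi01 i).
Qed.

Definition exit_value (phi : nat -> R) (g j : nat) : R :=
  limn (fun t => walk phi g t j).

Lemma cvg_walk phi g j : (forall i, 0 <= phi i <= 1) ->
  ((fun t => walk phi g t j) @ \oo --> exit_value phi g j)%classic.
Proof. exact: is_cvg_walk. Qed.

Lemma exit_value_bdry phi g j : (j == 0%N) || (g < j)%N ->
  exit_value phi g j = phi j.
Proof.
move=> bj; rewrite /exit_value; under eq_fun do rewrite walk_bdry //.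
exact: lim_cst.
Qed.

Lemma exit_value_harmonic phi g j : (forall i, 0 <= phi i <= 1) ->
  (0 < j <= g)%N ->
  exit_value phi g j =
  p * exit_value phi g j.+1 + (1 - p) * exit_value phi g j.-1.
Proof.
move=> phi01 bj; apply: cvg_lim => //; rewrite -cvg_shiftS.
rewrite (_ : mk_sequence _ = fun t =>
  p * walk phi g t j.+1 + (1 - p) * walk phi g t j.-1); last first.
  by apply/funext => t; rewrite -walkS.
by apply: cvgD; apply: cvgM; [exact: cvg_cst|exact: cvg_walk|exact: cvg_cst|
  exact: cvg_walk].
Qed.

Lemma exit_value_linear a b phi psi g j :
  (forall i, 0 <= phi i <= 1) -> (forall i, 0 <= psi i <= 1) ->
  limn (fun t => a * walk phi g t j + b * walk psi g t j) =
  a * exit_value phi g j + b * exit_value psi g j.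
Proof.
move=> phi01 psi01; apply: cvg_lim => //.
by apply: cvgD; apply: cvgM; [exact: cvg_cst|exact: cvg_walk|exact: cvg_cst|
  exact: cvg_walk].
Qed.

(* The walk leaves the interval almost surely: by the maximum principle the
   survival probability, harmonic inside and zero at both ends, vanishes. *)
Lemma exit_value1 g j : (j <= g.+1)%N -> exit_value (fun=> 1) g j = 1.
Proof.
have one01 : forall i : nat, 0 <= (1 : R) <= 1 by move=> _; rewrite ler01 lexx.
pose D i := 1 - exit_value (fun=> 1) g i.
have Dbdry i : (i == 0%N) || (g < i)%N -> D i = 0.
  by move=> bi; rewrite /D exit_value_bdry ?subrr.
have Dharm i : (0 < i <= g)%N -> D i = p * D i.+1 + (1 - p) * D i.-1.
  by move=> bi; rewrite /D (exit_value_harmonic one01 bi); ring.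
have D0 i : 0 <= D i.
  rewrite subr_ge0; apply: limr_le; first exact: is_cvg_walk.
  by apply: nearW => t; apply: walk_le1.
suff D_le0 i : (i <= g.+1)%N -> D i <= 0.
  move=> lej; apply/eqP; rewrite eq_sym -subr_eq0; apply/eqP/le_anti.
  by rewrite D_le0 // D0.
(* For [p = 0] the walk only moves left, and vanishing spreads from the end [0]; the propagation to
   the right used otherwise divides by [p]. *)
case: (eqVneq p 0) => [p0|p_neq0].
  elim: i => [|i IH] lei; first by rewrite Dbdry.
  case: (leqP i.+1 g) => ltig; last by rewrite Dbdry ?ltig ?orbT.
  by rewrite Dharm // p0 mul0r add0r subr0 mul1r IH // ltnW.
have p_gt0 : 0 < p by rewrite lt_def p_neq0.
case: (@Order.TotalTheory.arg_maxP _ _ 'I_g.+2 ord0 xpredT (fun k => D k)) => //.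
move=> k0 _ maxD lei.
apply: le_trans (maxD (Ordinal (lei : (i < g.+2)%N)) isT) _ => /=.
have Dmax l : (l <= g.+1)%N -> D l <= D k0.
  by move=> lel; exact: (maxD (Ordinal (lel : (l < g.+2)%N)) isT).
(* The maximum of [D] propagates step by step to the right until it meets the end [g.+1], where [D]
   is 0. *)
suff : forall d, (k0 + d <= g.+1)%N -> D k0 <= D (k0 + d)%N.
  move=> /(_ (g.+1 - k0)%N); rewrite subnKC; last by rewrite -ltnS.
  by move=> /(_ (leqnn _)) /le_trans; apply; rewrite Dbdry ?ltnSn ?orbT.
elim=> [|d IH] led; first by rewrite addn0.
case: (posnP (k0 + d)) => [k0d0|k0d_gt0].
  have k00 : k0 = 0%N :> nat by lia.
  by rewrite [X in X <= _]Dbdry ?D0 // k00.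
have bk : (0 < k0 + d <= g)%N by lia.
have := IH (leq_trans (leq_addr 1 _) _); rewrite addn1 -addnS => /(_ led).
rewrite (Dharm _ bk).
have : D (k0 + d).-1 <= D k0 by apply: Dmax; lia.
have q_ge0 : 0 <= 1 - p by rewrite subr_ge0.
move=> /(ler_wpM2l q_ge0) le1 le2; rewrite addnS -(ler_pM2l p_gt0).
move: (D k0) (D _) (D _) le1 le2 => a b c; clear; lra.
Qed.

Definition exit_left (g j : nat) : R := exit_value (fun i => (i == 0%N)%:R) g j.
Definition exit_right (g j : nat) : R := exit_value (fun i => (g < i)%N%:R) g j.

Lemma exit_leftD_right g j : (j <= g.+1)%N -> exit_left g j + exit_right g j = 1.
Proof.
move=> lej; rewrite -(exit_value1 lej) -[exit_left g j]mul1r.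
rewrite -[exit_right g j]mul1r -exit_value_linear; last 2 first.
  by move=> i; case: (i == _); rewrite ?ler01 ?lexx.
  by move=> i; case: (g < i)%N; rewrite ?ler01 ?lexx.
congr (limn _); apply/funext => t; rewrite -walk_linear.
by apply: eq_walk; rewrite //= ?ltn0 ?ltnSn ?mulr0 ?mulr1 ?addr0 ?add0r.
Qed.

(** Inside an arc, the circle walk is the line walk read through [cshift x]. The payoff tests both
    ends against [f], as they are the same site when [X] is a singleton. *)
Lemma hit_walk n (X : {set 'I_n}) (x f : 'I_n) t j :
  x \in X -> (j <= (gap X x).+1)%N ->
  hit p t (~: X) (cshift x j) f =
  walk (fun i => (cshift x i == f)%:R) (gap X x) t j.
Proof.
move=> xX; elim: t j => [|t IH] j lej /=; rewrite inE negbK.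
  all: case: (boolP ((j == 0%N) || _)) => [bj|nbj].
  all: try by case/orP: bj => [/eqP ->|ltj]; rewrite ?xX //;
    (have -> : j = (gap X x).+1 by lia); rewrite (gapP xX).1.
  all: rewrite (negbTE (gap_cshift_notin xX _)) //; last by lia.
rewrite -!IH; [|lia|lia].
congr (_ + _ * hit _ _ _ _ _).
by case: j nbj {lej} => // j _; exact: ordSK.
Qed.

Lemma absorb_exit n (X : {set 'I_n}) (x f : 'I_n) j :
  x \in X -> (j <= (gap X x).+1)%N ->
  absorb p (~: X) (cshift x j) f =
  (x == f)%:R * exit_left (gap X x) j +
  (cshift x (gap X x).+1 == f)%:R * exit_right (gap X x) j.
Proof.
move=> xX lej; rewrite -exit_value_linear; last 2 first.
  by move=> i; case: (i == _); rewrite ?ler01 ?lexx.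
  by move=> i; case: (_ < i)%N; rewrite ?ler01 ?lexx.
congr (limn _); apply/funext => t; rewrite hit_walk // -walk_linear.
by apply: eq_walk; rewrite //= ?ltn0 ?ltnSn ?mulr0 ?mulr1 ?addr0 ?add0r.
Qed.

(** The start [j = 0] is the free site itself: it adds 1 to the left sum and 0 to the right one, so
    a car choosing the last spot directly is counted on the left. *)
Definition sum_exit_left g : R := \sum_(j < g.+1) exit_left g j.
Definition sum_exit_right g : R := \sum_(j < g.+1) exit_right g j.

Lemma sum_exit g : sum_exit_left g + sum_exit_right g = g.+1%:R.
Proof.
rewrite -big_split /=.
under eq_bigr => j _ do rewrite exit_leftD_right ?(ltnW (ltn_ord j)) //.
by rewrite sumr_const card_ord.
Qed.

(** Before the last car, [f] is the left end of the arc that it starts and the right end of the arc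
    started at [x]; every other arc contributes 0. *)
Lemma sum_absorb n (X : {set 'I_n}) (x : 'I_n) i (f := cshift x i.+1) :
  x \in X -> (i < gap X x)%N ->
  \sum_v absorb p (~: (f |: X)) v f =
  sum_exit_left (gap X x - i.+1) + sum_exit_right i.
Proof.
move=> xX lti; have fX : f \notin X := (gapP xX).2 _ lti.
pose Y := f |: X; have fY : f \in Y by rewrite !inE eqxx.
have xY : x \in Y by rewrite !inE xX orbT.
rewrite (@sum_arcs _ _ Y); last by apply/set0Pn; exists f.
transitivity (\sum_(y in Y) ((y == f)%:R * sum_exit_left (gap Y y) +
   (y == x)%:R * sum_exit_right (gap Y y))).
  apply: eq_bigr => y yY; rewrite !mulr_sumr -big_split /=.
  apply: eq_bigr => j _; rewrite absorb_exit ?(ltnW (ltn_ord j)) //.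
  by rewrite next_setU1.
rewrite big_split /= (bigD1 f) //= eqxx mul1r big1 ?addr0; last first.
  by move=> y /andP[_ /negbTE ->]; rewrite mul0r.
rewrite (bigD1 x) //= eqxx mul1r big1 ?addr0; last first.
  by move=> y /andP[_ /negbTE ->]; rewrite mul0r.
by rewrite gap_setU1_right // gap_setU1_left.
Qed.

End Walk.

(** * Abel's identity *)

(** Both sides count pairs of disjoint subsets of sizes [a] and [k]. *)
Lemma mul_binCA (m a k : nat) : (k + a <= m)%N ->
  ('C(m, a) * 'C(m - a, k) = 'C(m, k) * 'C(m - k, a))%N.
Proof.
move=> le; apply/eqP; rewrite -(@eqn_pmul2r (a`! * k`! * (m - a - k)`!));
  last by rewrite !muln_gt0 !fact_gt0.
have e1 : ('C(m, a) * (a`! * (m - a)`!) = m`!)%N by apply: bin_fact; lia.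
have e2 : ('C(m, k) * (k`! * (m - k)`!) = m`!)%N by apply: bin_fact; lia.
have e3 : ('C(m - a, k) * (k`! * (m - a - k)`!) = (m - a)`!)%N.
  by apply: bin_fact; lia.
have e4 : ('C(m - k, a) * (a`! * (m - k - a)`!) = (m - k)`!)%N.
  by apply: bin_fact; lia.
rewrite -e3 in e1; rewrite -e4 in e2; have e : (m - k - a = m - a - k)%N by lia.
by rewrite e in e2; apply/eqP; transitivity m`!; [rewrite -e1 | rewrite -e2]; ring.
Qed.

(** The finite difference of order [N] kills polynomials of degree below [N]. Induction on [e]: one
    factor [c + a] is split, and [a] is absorbed into the binomial coefficient, lowering [N]. *)
Lemma finite_difference_power (R : comNzRingType) (N e : nat) (c : R) :
  (e < N)%N ->
  \sum_(a < N.+1) (-1) ^+ a * (c + a%:R) ^+ e *+ 'C(N, a) = 0.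
Proof.
elim: e N c => [|e IH] N c ltN.
  have := exprDn 1 (-1 : R) N; rewrite subrr expr0n.
  case: N ltN => // N _ e; apply: etrans (esym e).
  by apply: eq_bigr => a _; rewrite expr1n mul1r expr0 mulr1.
case: N ltN => // N; rewrite ltnS => ltN.
transitivity (c * \sum_(a < N.+2) (-1) ^+ a * (c + a%:R) ^+ e *+ 'C(N.+1, a) +
  \sum_(a < N.+2) (-1) ^+ a * (c + a%:R) ^+ e *+ (a * 'C(N.+1, a))).
  rewrite mulr_sumr -big_split /=; apply: eq_bigr => a _.
  by rewrite exprS; ring.
rewrite IH ?(ltn_trans ltN) // mulr0 add0r big_ord_recl mul0n mulr0n add0r.
transitivity (- (N.+1%:R) *
  \sum_(a < N.+1) (-1) ^+ a * ((c + 1) + a%:R) ^+ e *+ 'C(N, a)).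
  rewrite mulr_sumr; apply: eq_bigr => a _.
  rewrite /= /bump /= add1n -mul_bin_diag exprS /=.
  by have -> : c + a.+1%:R = c + 1 + a%:R; ring.
by rewrite IH // mulr0.
Qed.

(* Expand [(b+1)^b = ((m+2) - (a+1))^b]; every coefficient of [(m+2)^k] with
   [k < m] is then a finite difference of order [m-k] of a power [m-k-1]. *)
Lemma abel_identity (R : comNzRingType) (m : nat) :
  \sum_(a < m.+1) (a.+1%:R ^+ a.-1 * (m - a).+1%:R ^+ (m - a) *+ 'C(m, a)) =
  m.+2%:R ^+ m :> R.
Proof.
pose z : R := m.+2%:R.
transitivity (\sum_(a < m.+1) \sum_(k < m.+1 | (k + a <= m)%N)
   z ^+ k * ((-1) ^+ (m - a - k) * a.+1%:R ^+ (a.-1 + (m - a - k)) *+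
     ('C(m, a) * 'C(m - a, k)))).
  apply: eq_bigr => a _.
  have -> : (m - a).+1%:R = - a.+1%:R + z.
    rewrite /z addrC; apply/eqP; rewrite eq_sym subr_eq -natrD; apply/eqP.
    by congr (_%:R); have := ltn_ord a; lia.
  rewrite exprDn mulr_sumr.
  transitivity (\sum_(k < (m - a).+1) z ^+ k * ((-1) ^+ (m - a - k) *
     a.+1%:R ^+ (a.-1 + (m - a - k)) *+ ('C(m, a) * 'C(m - a, k)))).
    rewrite -sumrMnl; apply: eq_bigr => k _.
    by rewrite (exprNn a.+1%:R) exprD; move: (_%:R) => y; ring.
  rewrite (big_ord_widen m.+1 (fun k => z ^+ k * ((-1) ^+ (m - a - k) *
     a.+1%:R ^+ (a.-1 + (m - a - k)) *+ ('C(m, a) * 'C(m - a, k))))).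
    by apply: eq_bigl => k; have := ltn_ord a; lia.
  by rewrite ltnS leq_subr.
rewrite (exchange_big_dep xpredT) //= big_ord_recr /=.
rewrite [X in X + _]big1 ?add0r; last first.
  move=> k _; rewrite -mulr_sumr.
  rewrite [X in _ * X](_ : _ = \sum_(a < (m - k).+1)
    (-1) ^+ (m - k) * ((-1) ^+ a * (1 + a%:R) ^+ (m - k).-1 *+ 'C(m - k, a))
      *+ 'C(m, k)).
    rewrite sumrMnl -mulr_sumr finite_difference_power ?mulr0 ?mul0rn ?mulr0 //.
    by have := ltn_ord k; lia.
  rewrite (big_ord_widen m.+1 (fun a => (-1) ^+ (m - k) * ((-1) ^+ a *
    (1 + a%:R) ^+ (m - k).-1 *+ 'C(m - k, a)) *+ 'C(m, k))); last first.
    by rewrite ltnS leq_subr.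
  apply: eq_big => [a|a lea]; first by have := ltn_ord k; lia.
  have ltk := ltn_ord k.
  have -> : ('C(m, a) * 'C(m - a, k) = 'C(m, k) * 'C(m - k, a))%N.
    by apply: mul_binCA.
  have -> : (-1) ^+ (m - a - k) = (-1) ^+ (m - k) * (-1) ^+ a :> R.
    have -> : (m - k = (m - a - k) + a)%N by lia.
    by rewrite exprD -mulrA -expr2 sqrr_sign mulr1.
  (* At [a = 0] the truncated [a.-1] makes the exponents differ, but the base is 1. *)
  have -> : a.+1%:R ^+ (a.-1 + (m - a - k)) = (1 + a%:R) ^+ (m - k).-1 :> R.
    rewrite -[a.+1]add1n natrD; case: (posnP a) => [->|a0].
      by rewrite addr0 !expr1n.
    by congr (_ ^+ _); lia.
  by ring.
(* For [k = m] the constraint leaves only [a = 0], whose term is [z ^+ m]. *)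
rewrite (bigD1 ord0) ?addn0 //= big1 ?addr0.
  by rewrite subn0 subnn !expr0 bin0 binn mul1n ?expr1n !mulr1.
by move=> a /andP[lea /eqP a0]; case: a0; apply: val_inj => /=; lia.
Qed.

(** * The recursion on the number of cars *)

Section Weight.
Variable R : realType.

(** The numerator is the number of parking functions of length [l]; at [l = 0] the truncated
    exponent still gives 1. *)
Definition weight (l : nat) : R := (l.+1 ^ l.-1)%N%:R / l`!%:R.

Lemma weight_mulS l : weight l * l.+1%:R = (l.+1 ^ l)%N%:R / l`!%:R.
Proof.
rewrite /weight mulrAC -natrM; congr (_%:R / _).
by case: l => // l; rewrite expnSr.
Qed.

(** Abel's identity divided by the factorial of [m]: the factor [(m - i).+1] raises the exponent in
    the second weight by one. *)
Lemma sum_weight_conv m :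
  \sum_(i < m.+1) weight i * weight (m - i) * (m - i).+1%:R =
  m.+1%:R * weight m.+1.
Proof.
have fact_neq0 l : l`!%:R != 0 :> R by rewrite pnatr_eq0 -lt0n fact_gt0.
transitivity ((m.+2%:R ^+ m) / m`!%:R : R); last first.
  rewrite /weight /= factS natrM natrX; field.
  by rewrite fact_neq0 /= addrC natr1 pnatr_eq0.
rewrite -abel_identity mulr_suml; apply: eq_bigr => i _.
rewrite -mulrA weight_mulS /weight !natrX.
rewrite -(bin_fact (ltnSE (ltn_ord i))) !natrM -[X in _ = X / _]mulr_natr.
have bin_neq0 : 'C(m, i)%:R != 0 :> R.
  by rewrite pnatr_eq0 -lt0n bin_gt0 -ltnS.
move: ('C(m, i)%:R) bin_neq0 (fact_neq0 i) (fact_neq0 (m - i)%N) => c c0.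
move: (i`!%:R) ((m - i)`!%:R) (_ ^+ _) (_ ^+ _) => a b u v a0 b0.
by field; rewrite c0 a0 b0.
Qed.

(* Only here does [p] drop out: the two halves of the split block are
   exchangeable, and exiting left or right from the same block are
   complementary events. *)
Lemma sum_weight_exit (p : R) g : 0 <= p -> p <= 1 ->
  \sum_(i < g) weight i * weight (g - i.+1) *
    (sum_exit_left p (g - i.+1) + sum_exit_right p i) = g%:R * weight g.
Proof.
move=> p0 p1; case: g => [|m]; first by rewrite big_ord0 mul0r.
rewrite -sum_weight_conv.
under eq_bigr do rewrite mulrDr subSS.
rewrite big_split /= [X in _ + X](reindex_inj rev_ord_inj) /= -big_split /=.
apply: eq_bigr => i _; have lei : (i <= m)%N := ltnSE (ltn_ord i).
by rewrite subSS subKn // [weight (m - i) * _]mulrC -mulrDr sum_exit.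
Qed.

(** The final set and the last spot [f] determine the earlier set, so the sum over sets becomes a
    sum over [f]. *)
Lemma park_distS n (p : R) k (O : {set 'I_n}) :
  park_dist p k.+1 O =
  \sum_(f in O) park_dist p k (O :\ f) *
    (n%:R^-1 * \sum_v absorb p (O :\ f) v f).
Proof.
rewrite /=.
transitivity (\sum_(O' : {set 'I_n}) \sum_(f | (f \notin O') && (O == f |: O'))
  park_dist p k O' * (n%:R^-1 * \sum_v absorb p O' v f)).
  apply: eq_bigr => O' _; rewrite -mulr_sumr; congr (_ * _).
  by rewrite -!mulr_sumr exchange_big.
rewrite (exchange_big_dep (mem O)) /=; last first.
  by move=> O' f _ /andP[_ /eqP ->]; rewrite !inE eqxx.
apply: eq_bigr => f fO; rewrite (big_pred1 (O :\ f)) // => O' /=.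
apply/andP/eqP => [[fO' /eqP ->]|->]; first by rewrite setU1K.
by rewrite !inE eqxx /= finset.setD1K.
Qed.

(** As [k < n], a free site remains and the occupied sites split into blocks. Summing over the last
    spot within one block gives the whole product times the length of that block. *)
Lemma park_dist_gap n (p : R) k (O : {set 'I_n}) : 0 <= p -> p <= 1 ->
  (k < n)%N -> #|O| = k ->
  park_dist p k O =
  (n%:R ^+ k)^-1 * k`!%:R * \prod_(x in ~: O) weight (gap (~: O) x).
Proof.
move=> p0 p1; elim: k O => [|k IH] O ltkn cardO.
  have -> : O = finset.set0 by apply/eqP; rewrite -cards_eq0 cardO.
  rewrite /= eqxx expr0 invr1 fact0 !mul1r big1 // => x _.
  rewrite (_ : gap _ _ = 0%N) /weight ?divr1 //.
  by apply: gap_eq => //; rewrite !inE.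
pose X := ~: O; have OX : O = ~: X by rewrite finset.setCK.
have X0 : X != finset.set0.
  by rewrite -card_gt0 cardsCs finset.setCK card_ord cardO subn_gt0.
rewrite park_distS -/X.
transitivity (\sum_(f in ~: X) park_dist p k (~: (f |: X)) *
    (n%:R^-1 * \sum_v absorb p (~: (f |: X)) v f)).
  rewrite -OX; apply: eq_bigr => f fO.
  suff -> : O :\ f = ~: (f |: X) by [].
  by apply/setP => y; rewrite !inE negb_or negbK.
rewrite (sum_arcsC _ X0).
transitivity (\sum_(x in X) (gap X x)%:R *
    ((n%:R ^+ k.+1)^-1 * k`!%:R * \prod_(y in X) weight (gap X y))).
  apply: eq_bigr => x xX; rewrite (bigD1 x) //=.
  set P := \prod_(_ in _ | _) _.
  transitivity ((n%:R ^+ k.+1)^-1 * k`!%:R * P * \sum_(i < gap X x)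
    weight i * weight (gap X x - i.+1) *
    (sum_exit_left p (gap X x - i.+1) + sum_exit_right p i)).
    rewrite mulr_sumr; apply: eq_bigr => i _.
    rewrite (sum_absorb p0 p1 xX (ltn_ord i)) IH ?(ltnW ltkn) //; last first.
      rewrite cardsCs finset.setCK cardsU1 (gapP xX).2 // card_ord.
      by rewrite cardsCs finset.setCK card_ord cardO; lia.
    rewrite finset.setCK (prod_gap_setU1 _ xX) // -/P exprS invfM; ring.
  by rewrite sum_weight_exit //; ring.
(* The block lengths add up to [k.+1], which turns the factorial of [k] into that of [k.+1]. *)
rewrite -mulr_suml -natr_sum sum_gap // finset.setCK cardO factS natrM.
by rewrite -/X; ring.
Qed.

End Weight.

(** * Gaps and the sorted listing of the free sites *)

Lemma gap_Delta n (X : {set 'I_n}) (x : 'I_n) i : x \in X -> (i < #|X|)%N ->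
  nth 0%N (sorted_elems X) i = x -> Delta X i = gap X x.
Proof.
set s := sorted_elems X => xX lti si; apply/esym.
have size_s : size s = #|X| by rewrite size_sort size_map -cardE.
have mem_s (y : 'I_n) : (val y \in s) = (y \in X).
  by rewrite mem_sort mem_map ?mem_enum //; exact: val_inj.
have sorted_s : sorted ltn s.
  rewrite ltn_sorted_uniq_leq sort_sorted ?andbT; last exact: leq_total.
  by rewrite sort_uniq map_inj_uniq ?enum_uniq //; exact: val_inj.
have lt_nth a b : (a < b < #|X|)%N -> (nth 0 s a < nth 0 s b)%N.
  move=> /andP[ltab ltb].
  by apply: (sorted_ltn_nth ltn_trans) => //; rewrite inE size_s ?(ltn_trans ltab).
have nth_X a : (a < #|X|)%N -> exists2 y : 'I_n, y \in X & val y = nth 0%N s a.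
  rewrite -size_s => /(mem_nth 0%N); rewrite mem_sort => /mapP[y].
  by rewrite mem_enum => yX ->; exists y.
have ltj : (i.+1 %% #|X| < #|X|)%N by rewrite ltn_mod; lia.
have [y yX sy] := nth_X _ ltj.
have ltx := ltn_ord x; have lty := ltn_ord y.
have DE : Delta X i = ((y + n - x - 1) %% n)%N by rewrite /Delta -/s si -sy.
have lt_Dn : (Delta X i < n)%N by rewrite DE ltn_mod; lia.
have le_nth a b : (a <= b < #|X|)%N -> (nth 0 s a <= nth 0 s b)%N.
  by case/andP; rewrite leq_eqVlt => /orP[/eqP -> //|ltab] ltb;
    rewrite ltnW // lt_nth ?ltab.
apply: gap_eq => // [|j ltjD].
  suff -> : cshift x (Delta X i).+1 = y by [].
  apply: val_inj; rewrite val_cshift DE addnS -addSn modnDmr.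
  have -> : (x.+1 + (y + n - x - 1) = y + n)%N by lia.
  by rewrite modnDr modn_small.
apply/negP; rewrite -mem_s => /(nthP 0%N)[m]; rewrite size_s => ltm zm.
have {zm} : nth 0%N s m = ((x + j.+1) %% n)%N :> nat by rewrite -val_cshift.
(* If [x] is not the last listed site, [Delta] does not wrap, and a site of [X] between [x] and [y]
   would have its rank strictly between [i] and [i.+1]. *)
case: (ltnP i.+1 #|X|) => [ltSi|leSi].
  have syS : nth 0%N s i.+1 = y by rewrite -[RHS]/(val y) sy modn_small.
  have ltxy : (x < y)%N by rewrite -si -syS lt_nth ?leqnn.
  have DE' : Delta X i = (y - x - 1)%N.
    rewrite DE (_ : (y + n - x - 1 = y - x - 1 + n)%N); last by lia.
    by rewrite modnDr modn_small //; lia.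
  rewrite modn_small; last by lia.
  case: (leqP m i) => [lemi|ltim].
    by have := le_nth m i; rewrite lemi lti si => /(_ isT); lia.
  have := le_nth i.+1 m; rewrite ltim ltm => /(_ isT).
  by rewrite syS; lia.
(* Here the arc wraps from the largest site [x] to the smallest, [y]. All listed numbers lie in
   [[y, x]], which the inner points of the arc avoid both before and after passing [n]. *)
have Si : i.+1 = #|X| by apply/eqP; rewrite eqn_leq lti.
have sy0 : y = nth 0%N s 0 :> nat by rewrite -[LHS]/(val y) sy Si modnn.
have leyx : (y <= x)%N by rewrite sy0 -si le_nth ?lti.
have DE' : Delta X i = (y + n - x - 1)%N by rewrite DE modn_small //; lia.
have lemx : (nth 0 s m <= x)%N by rewrite -si le_nth // lti andbT -ltnS Si.
have leym : (y <= nth 0 s m)%N by rewrite sy0 le_nth.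
case: (ltnP (x + j.+1) n) => [lt|le]; first by rewrite modn_small //; lia.
rewrite -[(x + j.+1)%N](subnK le) modnDr modn_small; lia.
Qed.

Lemma prod_Delta (R : comNzRingType) (F : nat -> R) n (X : {set 'I_n}) :
  \prod_(i < #|X|) F (Delta X i) = \prod_(x in X) F (gap X x).
Proof.
have size_s : size (sorted_elems X) = #|X| by rewrite size_sort size_map -cardE.
case: (posnP n) => [n0|n_gt0].
  have -> : X = finset.set0 by apply/setP => x; have := ltn_ord x; lia.
  by rewrite finset.cards0 big_ord0 finset.big_set0.
(* The listing holds natural numbers; [insubd] reads them back as sites, its default covering only
   numbers out of range. *)
pose G a := F (gap X (insubd (Ordinal n_gt0) a)).
transitivity (\prod_(a <- sorted_elems X) G a).
  rewrite (big_nth 0%N) size_s big_mkord; apply: eq_bigr => i _.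
  have : nth 0%N (sorted_elems X) i \in sorted_elems X by rewrite mem_nth ?size_s.
  rewrite mem_sort => /mapP[x]; rewrite mem_enum => xX e.
  by rewrite /G e valKd (gap_Delta xX (ltn_ord i)).
rewrite (perm_big _ (permEl (perm_sort _ _))) big_map big_enum /=.
by apply: eq_bigr => x _; rewrite /G valKd.
Qed.

Theorem mainTheorem4 (R : realType) (n Nb : nat) (p : R)
  (hn : (1 <= n)%N) (hNb : (Nb < n)%N) (hp0 : 0 <= p) (hp1 : p <= 1)
  (X : {set 'I_n}) (hX : #|X| = (n - Nb)%N) :
  prob_free_set p Nb X =
    (n%:R ^+ Nb)^-1 *
    ((Nb`!)%:R / \prod_(i < n - Nb) ((Delta X i)`!)%:R) *
    \prod_(i < n - Nb) (((Delta X i).+1 ^ (Delta X i).-1)%N)%:R.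
Proof.
have cardXC : #|~: X| = Nb by rewrite cardsCs finset.setCK card_ord hX; lia.
rewrite /prob_free_set (park_dist_gap hp0 hp1 hNb cardXC) finset.setCK.
rewrite -hX -(prod_Delta (@weight R)) prodf_div; ring.
Qed.
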